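(* Let $\lambda_1,\lambda_2\in\mathbb{C}$ with $\lambda_1,\lambda_2,\lambda_1+\lambda_2\notin\frac12\mathbb{Z}_{\ge0}$, let $J\in\mathbb{Z}_{\ge0}$, $\lambda=\lambda_1+\lambda_2-J$, and let $a_j\in\lambda_j-\mathbb{Z}_{\ge0}$ ($j=1,2$), $a\in\lambda-\mathbb{Z}_{\ge0}$ with $a=a_1+a_2$. Then $$\begin{bmatrix}\lambda_1&\lambda_2&\lambda\\ a_1&a_2&a\end{bmatrix}^\psi_q=(-1)^{-J}q^{(\lambda_1-a_1)(\lambda_1+a_1-1)+(\lambda_2-a_2)(\lambda_2+a_2-1)-(\lambda-a)(\lambda+a-1)}\begin{bmatrix}\lambda_2&\lambda_1&\lambda\\ a_2&a_1&a\end{bmatrix}^\psi_{q^{-1}},$$ $$\begin{bmatrix}\lambda_1&\lambda_2&\lambda\\ a_1&a_2&a\end{bmatrix}^\pi_q=(-1)^{-J}q^{-(\lambda_1-a_1)(\lambda_1+a_1-1)-(\lambda_2-a_2)(\lambda_2+a_2-1)+(\lambda-a)(\lambda+a-1)}\begin{bmatrix}\lambda_2&\lambda_1&\lambda\\ a_2&a_1&a\end{bmatrix}^\pi_{q^{-1}}.$$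
   Context: Notation: $q=e^{h/2}$ with $h\in\mathbb{C}$, $q^x:=e^{hx/2}$, $[x]_q=\frac{q^x-q^{-x}}{q-q^{-1}}$ (so $[x]_{q^{-1}}=[x]_q$), $[n]_q!=\prod_{s=1}^n[s]_q$, $[0]_q!=1$, $(-1)^{J/2}:=e^{i\pi J/2}$. The parameter $q$ is generic: $[x]_q\neq0$ for every nonzero $x\in\mathbb{Z}+2\mathbb{Z}\lambda_1+2\mathbb{Z}\lambda_2$. Terms with $[n]_q!$, $n$ a negative integer, in the denominator are omitted; empty products equal $1$. The $q3j$-symbols for embeddings $M_\lambda\hookrightarrow M_{\lambda_1}\otimes M_{\lambda_2}$ of Verma modules of $U_q(\mathfrak{sl}_2)$ are, for $\lambda=\lambda_1+\lambda_2-J$ and $a=a_1+a_2$, $$\begin{bmatrix}\lambda_1&\lambda_2&\lambda\\ a_1&a_2&a\end{bmatrix}^\psi_q=(-1)^{\frac J2+\lambda_1-a_1}q^{(\lambda_2^2-a_2^2)-(\lambda^2-a^2)-(\lambda_1-a_1)}\frac{[\lambda-a]_q!\,\Delta(\lambda_1,\lambda_2,\lambda)}{\prod_{j=1}^{\lambda-a}[\lambda+a+j]_q}\sum_{z+w=\lambda-a}(-1)^zq^{z(\lambda+a+1)}\frac{\prod_{j=1}^z[\lambda_1+a_1+j]_q\prod_{j=1}^w[\lambda_2+a_2+j]_q}{[z]_q![w]_q![\lambda_1-a_1-z]_q![\lambda_2-a_2-w]_q!}$$ ($z,w\in\mathbb{Z}_{\ge0}$), where $\Delta(\lambda_1,\lambda_2,\lambda)=\Big([J]_q!\prod_{j=0}^{J-1}\frac{[2\lambda_1-j]_q[2\lambda_2-j]_q}{[2\lambda+2+j]_q}\Big)^{1/2}$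 with a fixed choice of square root, the same for $(\lambda_1,\lambda_2,\lambda)$ and $(\lambda_2,\lambda_1,\lambda)$ and the same for $q$ and $q^{-1}$. The symbols for projections are $$\begin{bmatrix}\lambda_1&\lambda_2&\lambda\\ a_1&a_2&a\end{bmatrix}^\pi_q=\frac{\alpha_{\lambda_1,\lambda_1-a_1}\alpha_{\lambda_2,\lambda_2-a_2}}{\alpha_{\lambda,\lambda-a}}\begin{bmatrix}\lambda_1&\lambda_2&\lambda\\ a_1&a_2&a\end{bmatrix}^\psi_q,\qquad\alpha_{\lambda,k}=\frac{(-1)^kq^{k(k-2\lambda+1)}[k]_q!}{\prod_{j=0}^{k-1}[2\lambda-j]_q}.$$ The subscript $q^{-1}$ means that $q^x$ is replaced by $q^{-x}$ everywhere in these formulas (including in $\alpha$). *)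

(* Defs.v *)
From mathcomp Require Import all_boot all_order all_algebra.
From mathcomp Require Import all_real_closed.
From mathcomp Require Import reals.
From mathcomp.analysis Require Import sequences exp trigo.

Set Implicit Arguments.
Unset Strict Implicit.
Unset Printing Implicit Defensive.

Import Order.TTheory GRing.Theory Num.Theory.

Local Open Scope ring_scope.
Local Open Scope complex_scope.

Section QNumbers.
Variable R : realType.
Implicit Types h x z : R[i].

Definition cexp z : R[i] :=
  (expR (complex.Re z))%:C * (cos (complex.Im z) +i* sin (complex.Im z)).

(* (-1)^x := e^(i pi x); used for the half-integer exponent J/2. *)
Definition neg1pow x : R[i] := cexp ((0 +i* pi) * x).

(* q^x for q = e^(h/2).  The parameter is h rather than q, since q alone does
   not determine q^x; replacing q^x by q^(-x) everywhere amounts to replacing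
   h by -h. *)
Definition qpow h x : R[i] := cexp (h * x / 2).

(* If q = q^-1 this is 0 for every x, because _ / 0 = 0. *)
Definition qnum h x : R[i] :=
  (qpow h x - qpow h (- x)) / (qpow h 1 - qpow h (- 1)).

Definition qfact h (n : nat) : R[i] := \prod_(1 <= s < n.+1) qnum h s%:R.

(* [x]_q <> 0 for every nonzero x in Z + 2 Z lambda1 + 2 Z lambda2.  The case
   x = 1 forces q <> q^-1. *)
Definition generic h (lambda1 lambda2 : R[i]) : Prop :=
  forall k m n : int,
    let x := k%:~R + 2 * m%:~R * lambda1 + 2 * n%:~R * lambda2 in
    x != 0 -> qnum h x != 0.

(* The natural number equal to z, when z is one (see nat_of_complexK).  It
   turns differences such as lambda - a into factorial arguments and bounds of
   products and sums. *)
Definition nat_of_complex z : nat := Num.truncn (complex.Re z).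

Lemma nat_of_complexK (n : nat) : nat_of_complex n%:R = n.
Proof.
rewrite /nat_of_complex (_ : complex.Re n%:R = n%:R :> R) ?natrK //.
by rewrite -(rmorph_nat (real_complex R)).
Qed.

Lemma cexpD z1 z2 : cexp (z1 + z2) = cexp z1 * cexp z2.
Proof.
case: z1 z2 => [a b] [c d]; rewrite /cexp /= expRD cosD sinD rmorphM /=.
rewrite mulrACA; congr (_ * _).
by congr (_ +i* _); rewrite addrC.
Qed.

End QNumbers.

Section Symbols.
Variable R : realType.
Implicit Types h x lambda a : R[i].

(* Delta(lambda1, lambda2, lambda)^2, with J = lambda1 + lambda2 - lambda. *)
Definition Delta_sqr h lambda1 lambda2 lambda : R[i] :=
  let J := nat_of_complex (lambda1 + lambda2 - lambda) in
  qfact h J *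
  \prod_(0 <= j < J)
    (qnum h (2 * lambda1 - j%:R) * qnum h (2 * lambda2 - j%:R) /
     qnum h (2 * lambda + 2 + j%:R)).

(* Delta is a choice of square root that is the same for
   (lambda1, lambda2, lambda) and (lambda2, lambda1, lambda), and the same
   for q and q^-1. *)
Definition Delta_choice (Delta : R[i] -> R[i] -> R[i] -> R[i] -> R[i]) : Prop :=
  forall h lambda1 lambda2 lambda,
  [/\ Delta h lambda1 lambda2 lambda ^+ 2 = Delta_sqr h lambda1 lambda2 lambda,
      Delta h lambda2 lambda1 lambda = Delta h lambda1 lambda2 lambda
    & Delta (- h) lambda1 lambda2 lambda = Delta h lambda1 lambda2 lambda].

Lemma qnumN h x : qnum (- h) x = qnum h x.
Proof.
rewrite /qnum /qpow !mulrN !mulNr !opprK.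
by rewrite -opprB -[X in _ / X]opprB invrN mulrNN.
Qed.

Lemma Delta_choice_ex : exists Delta, Delta_choice Delta.
Proof.
exists (fun h l1 l2 l => sqrtC (Delta_sqr h l1 l2 l)) => h l1 l2 l.
split; first by rewrite sqrtCK.
- congr sqrtC; rewrite /Delta_sqr [l2 + l1]addrC; congr (_ * _).
  by apply: eq_bigr => j _; rewrite [qnum h _ * qnum h _]mulrC.
- congr sqrtC; rewrite /Delta_sqr /qfact; congr (_ * _).
  + by apply: eq_bigr => j _; rewrite qnumN.
  + by apply: eq_bigr => j _; rewrite !qnumN.
Qed.

(* Here w = n - z; terms with z > lambda1 - a1 or w > lambda2 - a2, which have
   a factorial of a negative integer in the denominator, are omitted. *)
Definition q3j_psi (Delta : R[i] -> R[i] -> R[i] -> R[i] -> R[i])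
    h lambda1 lambda2 lambda a1 a2 a : R[i] :=
  let J := nat_of_complex (lambda1 + lambda2 - lambda) in
  let n1 := nat_of_complex (lambda1 - a1) in
  let n2 := nat_of_complex (lambda2 - a2) in
  let n := nat_of_complex (lambda - a) in
  neg1pow (J%:R / 2 + (lambda1 - a1)) *
  qpow h ((lambda2 ^+ 2 - a2 ^+ 2) - (lambda ^+ 2 - a ^+ 2) - (lambda1 - a1)) *
  (qfact h n * Delta h lambda1 lambda2 lambda /
   \prod_(1 <= j < n.+1) qnum h (lambda + a + j%:R)) *
  \sum_(0 <= z < n.+1 | (z <= n1)%N && (n - z <= n2)%N)
    let w := (n - z)%N in
    (-1) ^+ z * qpow h (z%:R * (lambda + a + 1)) *
    ((\prod_(1 <= j < z.+1) qnum h (lambda1 + a1 + j%:R) *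
      \prod_(1 <= j < w.+1) qnum h (lambda2 + a2 + j%:R)) /
     (qfact h z * qfact h w * qfact h (n1 - z) * qfact h (n2 - w))).

Definition alpha h lambda (k : nat) : R[i] :=
  (-1) ^+ k * qpow h (k%:R * (k%:R - 2 * lambda + 1)) * qfact h k /
  \prod_(0 <= j < k) qnum h (2 * lambda - j%:R).

Definition q3j_pi (Delta : R[i] -> R[i] -> R[i] -> R[i] -> R[i])
    h lambda1 lambda2 lambda a1 a2 a : R[i] :=
  alpha h lambda1 (nat_of_complex (lambda1 - a1)) *
  alpha h lambda2 (nat_of_complex (lambda2 - a2)) /
  alpha h lambda (nat_of_complex (lambda - a)) *
  q3j_psi Delta h lambda1 lambda2 lambda a1 a2 a.

End Symbols.

(* Main.v *)
(** Substituting [z <-> w] in the sum exchanges the two tensor factors, and the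
    identity for the embedding symbols then holds term by term: the signs and
    the powers of [q] agree because [J + n = n1 + n2], where [n1], [n2], [n] are
    the differences [lambda1 - a1], [lambda2 - a2], [lambda - a], and everything
    else is invariant under [q -> q^-1].  The same invariance shows that passing
    from [q] to [q^-1] only changes the power of [q] in [alpha], which gives the
    identity for the projection symbols. *)
Require Import Defs.
From mathcomp Require Import all_boot all_order all_algebra.
From mathcomp Require Import all_real_closed.
From mathcomp Require Import reals.
From mathcomp.analysis Require Import sequences exp trigo.
From mathcomp Require Import ring.

Import Order.TTheory GRing.Theory Num.Theory.

Local Open Scope ring_scope.
Local Open Scope complex_scope.

Section SwapInversion.
#[local] Set Implicit Arguments.
#[local] Unset Strict Implicit.
Variable R : realType.
Implicit Types h x y lambda a : R[i].

Lemma cexp0 : cexp 0 = 1 :> R[i].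
Proof. by rewrite /cexp /= expR0 cos0 sin0 mul1r. Qed.

Lemma qpow0 h : qpow h 0 = 1.
Proof. by rewrite /qpow mulr0 mul0r cexp0. Qed.

Lemma qpowD h x y : qpow h (x + y) = qpow h x * qpow h y.
Proof. by rewrite /qpow mulrDr mulrDl cexpD. Qed.

Lemma qpow_oppl h x : qpow (- h) x = qpow h (- x).
Proof. by rewrite /qpow mulNr mulrN. Qed.

Lemma qpow_neq0 h x : qpow h x != 0.
Proof.
apply: contra_eq_neq (qpow0 h) => qx0.
by rewrite -(subrr x) qpowD qx0 mul0r eq_sym oner_neq0.
Qed.

Lemma qpowN h x : qpow h (- x) = (qpow h x)^-1.
Proof.
by apply: (mulIf (qpow_neq0 h x)); rewrite -qpowD addNr qpow0 mulVf ?qpow_neq0.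
Qed.

(** Separates the half-integer part [J / 2] of the exponent from the integer part, each unit of
    which contributes [e^(i pi) = -1]. *)
Lemma neg1powDn x (n : nat) : neg1pow (x + n%:R) = neg1pow x * (-1) ^+ n.
Proof.
elim: n => [|n IHn]; first by rewrite addr0 mulr1.
rewrite -[n.+1]addn1 natrD addrA exprD expr1 mulrA -IHn /neg1pow mulrDr cexpD.
congr (_ * _); rewrite mulr1 /cexp /= expR0 mul1r cospi sinpi.
by apply/eqP; rewrite eq_complex /= oppr0 !eqxx.
Qed.

Lemma qfact_opp h n : qfact (- h) n = qfact h n.
Proof. by apply: eq_bigr => s _; rewrite qnumN. Qed.

Lemma prod_qnum_opp h m n (f : nat -> R[i]) :
  \prod_(m <= j < n) qnum (- h) (f j) = \prod_(m <= j < n) qnum h (f j).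
Proof. by apply: eq_bigr => j _; rewrite qnumN. Qed.

(** For [k = lambda - a] the exponent [k (k - 2 lambda + 1)] in [alpha] is
    [- (lambda - a) (lambda + a - 1)]; inverting [q] negates it, hence the factor 2. *)
Lemma alpha_opp h lambda a (k : nat) : a = lambda - k%:R ->
  alpha h lambda k =
  qpow h (- (2 * ((lambda - a) * (lambda + a - 1)))) * alpha (- h) lambda k.
Proof.
move=> ->; rewrite /alpha qpow_oppl qfact_opp prod_qnum_opp.
rewrite [RHS]mulrA; congr (_ / _); rewrite [RHS]mulrA; congr (_ * _).
rewrite [RHS]mulrCA -qpowD; congr (_ * qpow h _); ring.
Qed.

(** Reversing the sum replaces [z] by [n - z]. With [c = lambda + a + 1], [q^((n - z) c)] splits
    into [q^(n c)], which is pulled out, and [q^(- z c)], the power that [q^-1] calls for. *)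
Lemma q3j_sum_swap h lambda1 lambda2 lambda a1 a2 a (n1 n2 n : nat) :
  \sum_(0 <= z < n.+1 | (z <= n1)%N && (n - z <= n2)%N)
    (-1) ^+ z * qpow h (z%:R * (lambda + a + 1)) *
    ((\prod_(1 <= j < z.+1) qnum h (lambda1 + a1 + j%:R) *
      \prod_(1 <= j < (n - z).+1) qnum h (lambda2 + a2 + j%:R)) /
     (qfact h z * qfact h (n - z) * qfact h (n1 - z) *
      qfact h (n2 - (n - z)))) =
  (-1) ^+ n * qpow h (n%:R * (lambda + a + 1)) *
  \sum_(0 <= z < n.+1 | (z <= n2)%N && (n - z <= n1)%N)
    (-1) ^+ z * qpow (- h) (z%:R * (lambda + a + 1)) *
    ((\prod_(1 <= j < z.+1) qnum (- h) (lambda2 + a2 + j%:R) *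
      \prod_(1 <= j < (n - z).+1) qnum (- h) (lambda1 + a1 + j%:R)) /
     (qfact (- h) z * qfact (- h) (n - z) * qfact (- h) (n2 - z) *
      qfact (- h) (n1 - (n - z)))).
Proof.
(* The bound [z <= n] joins the summation condition: with truncated subtraction, [n - (n - z) = z]
   depends on it. *)
rewrite big_nat_rev mulr_sumr big_nat_cond [RHS]big_nat_cond /= add0n.
apply: eq_big => z; rewrite subSS.
  by case: ltnP => //= z_le_n; rewrite subKn // andbC.
case/andP=> /= z_le_n _; rewrite subKn //.
rewrite [RHS]mulrA; congr (_ * (_ / _)).
- rewrite mulrACA qpow_oppl -qpowD; congr (_ * qpow h _).
    by rewrite -signr_odd oddB // signr_addb !signr_odd.
  by rewrite natrB //; ring.
- by rewrite [RHS]mulrC; congr (_ * _); apply: eq_bigr => j _; rewrite qnumN.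
- by rewrite 4!qfact_opp; ring.
Qed.

Lemma q3j_psi_swap Delta h lambda1 lambda2 lambda a1 a2 a (J n1 n2 n : nat) :
  Delta_choice Delta -> lambda = lambda1 + lambda2 - J%:R ->
  a1 = lambda1 - n1%:R -> a2 = lambda2 - n2%:R -> a = lambda - n%:R ->
  a = a1 + a2 ->
  q3j_psi Delta h lambda1 lambda2 lambda a1 a2 a =
    (-1) ^- J *
    qpow h ((lambda1 - a1) * (lambda1 + a1 - 1) +
            (lambda2 - a2) * (lambda2 + a2 - 1) -
            (lambda - a) * (lambda + a - 1)) *
    q3j_psi Delta (- h) lambda2 lambda1 lambda a2 a1 a.
Proof.
move=> DeltaP lambdaE a1E a2E aE a_sum.
have JE : lambda1 + lambda2 - lambda = J%:R by rewrite lambdaE; ring.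
have n1E : lambda1 - a1 = n1%:R by rewrite a1E; ring.
have n2E : lambda2 - a2 = n2%:R by rewrite a2E; ring.
have nE : lambda - a = n%:R by rewrite aE; ring.
(* Checked in [R[i]], into which the natural numbers embed injectively. *)
have addJn : (J + n = n1 + n2)%N.
  apply/eqP; rewrite -(eqr_nat R[i]) !natrD -JE -nE -n1E -n2E a_sum.
  by apply/eqP; ring.
rewrite /q3j_psi [lambda2 + lambda1]addrC JE n1E n2E nE !nat_of_complexK.
rewrite q3j_sum_swap qfact_opp prod_qnum_opp.
(* The coherent choice of square roots enters here: the squares alone would fix [Delta] only up to
   sign. *)
have [_ _ ->] := DeltaP h lambda2 lambda1 lambda.
have [_ -> _] := DeltaP h lambda1 lambda2 lambda.
rewrite !neg1powDn qpow_oppl.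
set C := qfact h n * _ / _; set S := \sum_(_ <= z < _ | _) _.
(* Signs are their own inverses, so only parities matter, and [addJn] relates them. *)
have signE : (-1) ^+ n1 * (-1) ^+ n = (-1) ^- J * (-1) ^+ n2 :> R[i].
  rewrite -exprVn invrN1 -!exprD -signr_odd -[RHS]signr_odd; congr (_ ^+ _).
  by move/(congr1 odd): addJn; rewrite !oddD; do 4 case: (odd _).
(* [E] and [E'] are the prefactor exponents of the two symbols, [E'] negated because of [q^-1]. As
   [n (lambda + a) = lambda^2 - a^2], both sides of [powE] have exponent
   [lambda2^2 - a2^2 - n1 + n]. *)
set E := (lambda2 ^+ 2 - _ - _ - _); set E' := - (lambda1 ^+ 2 - _ - _ - _).
set F := n1%:R * _ + _ - _.
have powE : qpow h E * qpow h (n%:R * (lambda + a + 1)) = qpow h F * qpow h E'.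
  rewrite -!qpowD; congr qpow; rewrite /E /E' /F -n1E -n2E -nE a_sum; ring.
transitivity (neg1pow (J%:R / 2) * ((-1) ^+ n1 * (-1) ^+ n) *
  (qpow h E * qpow h (n%:R * (lambda + a + 1))) * C * S); first by ring.
rewrite signE powE; ring.
Qed.

(** The three [alpha] factors contribute minus twice the exponent found for the embedding symbols,
    which reverses its sign. *)
Lemma q3j_pi_swap Delta h lambda1 lambda2 lambda a1 a2 a (J n1 n2 n : nat) :
  Delta_choice Delta -> lambda = lambda1 + lambda2 - J%:R ->
  a1 = lambda1 - n1%:R -> a2 = lambda2 - n2%:R -> a = lambda - n%:R ->
  a = a1 + a2 ->
  q3j_pi Delta h lambda1 lambda2 lambda a1 a2 a =
    (-1) ^- J *
    qpow h (- ((lambda1 - a1) * (lambda1 + a1 - 1)) -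
            (lambda2 - a2) * (lambda2 + a2 - 1) +
            (lambda - a) * (lambda + a - 1)) *
    q3j_pi Delta (- h) lambda2 lambda1 lambda a2 a1 a.
Proof.
move=> DeltaP lambdaE a1E a2E aE a_sum.
rewrite /q3j_pi (q3j_psi_swap h DeltaP lambdaE a1E a2E aE a_sum).
have n1E : lambda1 - a1 = n1%:R by rewrite a1E; ring.
have n2E : lambda2 - a2 = n2%:R by rewrite a2E; ring.
have nE : lambda - a = n%:R by rewrite aE; ring.
rewrite [in nat_of_complex (lambda1 - a1)]n1E.
rewrite [in nat_of_complex (lambda2 - a2)]n2E.
rewrite [in nat_of_complex (lambda - a)]nE !nat_of_complexK.
rewrite (alpha_opp h a1E) (alpha_opp h a2E) (alpha_opp h aE).
set A1 := alpha _ lambda1 _; set A2 := alpha _ lambda2 _.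
set A := alpha _ lambda _; set S := q3j_psi _ _ _ _ _ _ _ _.
(* The remaining exponent identity is linear in these three products, so they become variables. *)
move: ((lambda1 - a1) * _) ((lambda2 - a2) * _) ((lambda - a) * _) => x1 x2 x.
rewrite invfM -qpowN opprK.
transitivity ((-1) ^- J *
  (qpow h (- (2 * x1)) * qpow h (- (2 * x2)) * qpow h (2 * x) *
   qpow h (x1 + x2 - x)) * (A2 * A1 / A * S)); first by ring.
rewrite -!qpowD; congr (_ * qpow h _ * _); ring.
Qed.
End SwapInversion.

Theorem theorem4p4 (R : realType)
    (Delta : R[i] -> R[i] -> R[i] -> R[i] -> R[i])
    (h lambda1 lambda2 lambda a1 a2 a : R[i]) (J : nat) :
  Delta_choice Delta ->
  generic h lambda1 lambda2 ->
  (forall n : nat, lambda1 <> n%:R / 2) ->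
  (forall n : nat, lambda2 <> n%:R / 2) ->
  (forall n : nat, lambda1 + lambda2 <> n%:R / 2) ->
  lambda = lambda1 + lambda2 - J%:R ->
  (exists n : nat, a1 = lambda1 - n%:R) ->
  (exists n : nat, a2 = lambda2 - n%:R) ->
  (exists n : nat, a = lambda - n%:R) ->
  a = a1 + a2 ->
  q3j_psi Delta h lambda1 lambda2 lambda a1 a2 a =
    (-1) ^- J *
    qpow h ((lambda1 - a1) * (lambda1 + a1 - 1) +
            (lambda2 - a2) * (lambda2 + a2 - 1) -
            (lambda - a) * (lambda + a - 1)) *
    q3j_psi Delta (- h) lambda2 lambda1 lambda a2 a1 a
  /\
  q3j_pi Delta h lambda1 lambda2 lambda a1 a2 a =
    (-1) ^- J *
    qpow h (- ((lambda1 - a1) * (lambda1 + a1 - 1)) -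
            (lambda2 - a2) * (lambda2 + a2 - 1) +
            (lambda - a) * (lambda + a - 1)) *
    q3j_pi Delta (- h) lambda2 lambda1 lambda a2 a1 a.
Proof.
move=> DeltaP _ _ _ _ lambdaE [n1 a1E] [n2 a2E] [n aE] a_sum.
split; first exact: q3j_psi_swap DeltaP lambdaE a1E a2E aE a_sum.
exact: q3j_pi_swap DeltaP lambdaE a1E a2E aE a_sum.
Qed.
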